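(* Let $(M,g)$ be a compact Riemannian manifold of dimension $n\ge 3$ whose metric is Chen–Nagano critical, i.e. there is a smooth 1-form $\theta$ on $M$ with $$E_g = B_g^*(\theta)+c\,g,\qquad c=-\frac{n-2}{2n}\,\bar s .$$ If $\theta$ is exact, $\theta=df$ with $f\in C^\infty(M)$, then this equation determines a gradient Ricci almost soliton structure $$\mathrm{Ric}_g-\mathrm{Hess}_g(f)=\lambda\, g,$$ where the soliton function $\lambda\in C^\infty(M)$ is given explicitly by $$\lambda=c+\tfrac12 s_g-\tfrac12\Delta_g f .$$
   Context: Manifolds are smooth and without boundary. $\mathrm{Ric}_g$ is the Ricci tensor, $s_g$ the scalar curvature, $E_g=\mathrm{Ric}_g-\tfrac12 s_g g$ the Einstein tensor, and $\bar s=\frac{1}{\mathrm{Vol}(M,g)}\int_M s_g\,dv_g$ the average scalar curvature. For a smooth 1-form $\theta$, $\delta\theta=-\nabla^i\theta_i$, $(\delta^*\theta)_{ij}=\tfrac12(\nabla_i\theta_j+\nabla_j\theta_i)$, and $B_g^*(\theta)=\delta^*\theta+\tfrac12(\delta\theta)\,g$. $\mathrm{Hess}_g(f)=\nabla df$ and $\Delta_g f=\mathrm{tr}_g(\mathrm{Hess}_g f)$. A gradient Ricci almost soliton structure on $(M,g)$ is a pair of smooth functions $(f,\lambda)$ with $\mathrm{Ric}_g-\mathrm{Hess}_g(f)=\lambda g$, where $\lambda$ is not required to be constant. *)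

(* Defs.v *)
From HB Require Import structures.
From mathcomp Require Import all_boot all_order all_algebra.
From mathcomp Require Import all_classical all_reals all_analysis.
Set Implicit Arguments.
Unset Strict Implicit.
Unset Printing Implicit Defensive.
Import Order.TTheory GRing.Theory Num.Theory.
Import numFieldNormedType.Exports.

Local Open Scope classical_set_scope.
Local Open Scope ring_scope.

Section Euclidean.
Variable R : realType.

Definition partial (n : nat) (a : 'I_n) (h : 'rV[R]_n -> R) : 'rV[R]_n -> R :=
  fun x => 'D_(delta_mx 0 a) h x.

Definition partials (n : nat) (s : seq 'I_n) (h : 'rV[R]_n -> R) :=
  foldr (@partial n) h s.

(* C^oo on U, meant for U open: all iterated partial derivatives exist and are
   continuous at every point of U. *)
Definition smooth_on (n : nat) (U : set 'rV[R]_n) (h : 'rV[R]_n -> R) : Prop :=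
  forall (s : seq 'I_n) (x : 'rV[R]_n), U x ->
    {for x, continuous (partials s h)} /\
    forall a : 'I_n, derivable (partials s h) x (delta_mx 0 a).

(* The n-dimensional Lebesgue integral as an iterated integral (Fubini); it is
   only applied to continuous functions with compact support. *)
Fixpoint integral_Rn (n : nat) : ('rV[R]_n -> R) -> R :=
  match n with
  | 0 => fun h => h 0
  | m.+1 => fun h => \int[lebesgue_measure]_t
      integral_Rn (fun v : 'rV[R]_m => h (row_mx (const_mx t : 'rV[R]_1) v))
  end.

End Euclidean.

(* param i is a total function, whose values outside coord i @` dom i are
   irrelevant. *)
Record smoothManifold (R : realType) (n : nat) := SmoothManifold {
  points :> topologicalType ;
  manifold_hausdorff : hausdorff_space points ;
  manifold_second_countable : @second_countable points ;
  chart : Type ;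
  dom : chart -> set points ;
  coord : chart -> points -> 'rV[R]_n ;
  param : chart -> 'rV[R]_n -> points ;
  dom_open : forall i, open (dom i) ;
  codom_open : forall i, open (coord i @` dom i) ;
  coordK : forall i p, dom i p -> param i (coord i p) = p ;
  coord_continuous : forall i, {within dom i, continuous (coord i)} ;
  param_continuous : forall i,
    {within coord i @` dom i, continuous (param i)} ;
  chart_cover : forall p, exists i, dom i p ;
  transition_smooth : forall i j (a : 'I_n),
    smooth_on (coord i @` (dom i `&` dom j))
              (fun x => coord j (param i x) 0 a)
}.

Section Manifold.
Variables (R : realType) (n : nat) (M : smoothManifold R n).
Implicit Types (i j : chart M) (p : M) (h f : M -> R).

Definition chart_at p : chart M := sval (cid (chart_cover p)).

Definition smooth_on_chart i h : Prop :=
  smooth_on (coord i @` dom i) (h \o param i).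

Definition smooth h : Prop := forall i, smooth_on_chart i h.

(* The partial derivative of h along the a-th coordinate of the chart i. *)
Definition pd i (a : 'I_n) h : M -> R :=
  fun p => partial a (h \o param i) (coord i p).

(* Entry (a, b) is the derivative of the b-th coordinate of the chart j along
   the a-th coordinate of the chart i. *)
Definition jac i j p : 'M[R]_n :=
  \matrix_(a, b) pd i a (fun q => coord j q 0 b) p.

(* Tensor fields are given by their components in each chart; the components
   in the chart i are irrelevant outside dom i. *)
Local Notation covector_field := (chart M -> M -> 'rV[R]_n).
Local Notation tensor2_field := (chart M -> M -> 'M[R]_n).

Definition covector_eq (s t : covector_field) : Prop :=
  forall i p, dom i p -> s i p = t i p.
Definition tensor2_eq (S T : tensor2_field) : Prop :=
  forall i p, dom i p -> S i p = T i p.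

Record oneForm := OneForm {
  oneForm_comp :> covector_field ;
  oneForm_smooth : forall i a, smooth_on_chart i (fun p => oneForm_comp i p 0 a) ;
  oneForm_change : forall i j p, dom i p -> dom j p ->
    oneForm_comp i p = oneForm_comp j p *m (jac i j p)^T
}.

Record riemannianMetric := RiemannianMetric {
  metric_comp :> tensor2_field ;
  metric_smooth : forall i a b, smooth_on_chart i (fun p => metric_comp i p a b) ;
  metric_change : forall i j p, dom i p -> dom j p ->
    metric_comp i p = jac i j p *m metric_comp j p *m (jac i j p)^T ;
  metric_sym : forall i p, dom i p -> (metric_comp i p)^T = metric_comp i p ;
  metric_pos : forall i p, dom i p -> forall v : 'rV[R]_n, v != 0 ->
    0 < (v *m metric_comp i p *m v^T) 0 0
}.

Definition differential f : covector_field := fun i p => \row_a pd i a f p.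

Variable g : riemannianMetric.

Definition ginv i p : 'M[R]_n := invmx (g i p).

(* christoffel i c a b is Gamma^c_{ab} for the Levi-Civita connection. *)
Definition christoffel i (c a b : 'I_n) : M -> R := fun p =>
  2^-1 * \sum_d ginv i p c d *
    (pd i a (fun q => g i q b d) p + pd i b (fun q => g i q a d) p
     - pd i d (fun q => g i q a b) p).

(* riemann i a b c d is the component along the d-th coordinate vector of
   R(e_a, e_b) e_c, where R(X, Y) = [nabla_X, nabla_Y] - nabla_[X, Y]. *)
Definition riemann i (a b c d : 'I_n) : M -> R := fun p =>
  pd i a (christoffel i d b c) p - pd i b (christoffel i d a c) p
  + \sum_e (christoffel i d a e p * christoffel i e b c p
            - christoffel i d b e p * christoffel i e a c p).

Definition Ric : tensor2_field := fun i p =>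
  \matrix_(b, c) \sum_a riemann i a b c a p.

(* The g-trace of a (0,2)-tensor field. It does not depend on the chart, so it
   is computed in a chosen chart around each point. *)
Definition trace_g (T : tensor2_field) : M -> R := fun p =>
  \sum_a \sum_b ginv (chart_at p) p a b * T (chart_at p) p a b.

Definition scal : M -> R := trace_g Ric.

Definition einstein : tensor2_field := fun i p =>
  Ric i p - (2^-1 * scal p) *: g i p.

(* Entry (a, b) is nabla_a t_b. *)
Definition nabla (t : covector_field) : tensor2_field := fun i p =>
  \matrix_(a, b) (pd i a (fun q => t i q 0 b) p
                  - \sum_c christoffel i c a b p * t i p 0 c).

Definition delta (t : covector_field) : M -> R := fun p => - trace_g (nabla t) p.

Definition deltastar (t : covector_field) : tensor2_field := fun i p =>
  2^-1 *: (nabla t i p + (nabla t i p)^T).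

Definition Bstar (t : covector_field) : tensor2_field := fun i p =>
  deltastar t i p + (2^-1 * delta t p) *: g i p.

Definition Hess f : tensor2_field := nabla (differential f).

Definition laplacian f : M -> R := trace_g (Hess f).

(* A finite smooth partition of unity on M, subordinate to chart domains. *)
Definition partition_of_unity (m : nat) (c : 'I_m -> chart M)
    (rho : 'I_m -> M -> R) : Prop :=
  [/\ forall k, smooth (rho k),
      forall k p, 0 <= rho k p,
      forall k, closure [set p | rho k p != 0] `<=` dom (c k)
    & forall p, \sum_(k < m) rho k p = 1].

Definition chart_integral i h : R :=
  integral_Rn ((fun x => h (param i x) * Num.sqrt (\det (g i (param i x))))
                 \_ (coord i @` dom i)).

(* The integral against dv_g of a continuous function on a compact M: the value
   does not depend on the partition of unity used to compute it. *)
Definition integral_dv h : R :=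
  xget 0 [set I : R | exists (m : nat) (c : 'I_m -> chart M)
                        (rho : 'I_m -> M -> R),
    partition_of_unity c rho /\
    I = \sum_(k < m) chart_integral (c k) (fun p => rho k p * h p)].

Definition volume : R := integral_dv (fun=> 1).

Definition average_scal : R := volume^-1 * integral_dv scal.

Definition CN_const : R := - ((n%:R - 2) / (2 * n%:R)) * average_scal.

Definition Chen_Nagano_equation (t : oneForm) : Prop :=
  tensor2_eq einstein (fun i p => Bstar t i p + CN_const *: g i p).

Definition gradient_Ricci_almost_soliton f (lam : M -> R) : Prop :=
  [/\ smooth f, smooth lam
    & tensor2_eq (fun i p => Ric i p - Hess f i p)
                 (fun i p => lam p *: g i p)].

End Manifold.

(* Main.v *)
Require Import Defs.
From mathcomp Require Import all_boot all_order all_algebra.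
From mathcomp Require Import all_classical all_reals all_analysis.
From mathcomp Require Import ring.
Set Implicit Arguments.
Unset Strict Implicit.
Unset Printing Implicit Defensive.
Import Order.TTheory GRing.Theory Num.Theory.
Import numFieldNormedType.Exports.
Local Open Scope classical_set_scope.
Local Open Scope ring_scope.

(* For an exact theta = df, the operator delta^* gives the Hessian of f: by
   Schwarz's theorem and the symmetry of the Christoffel symbols Hess f is
   symmetric. Moving the multiples of g to one side of the Chen-Nagano equation
   then gives Ric - Hess f = lambda g. Smoothness of lambda follows from this
   identity: the components of Ric, Hess f and g are smooth in every chart, and
   lambda is the quotient of two diagonal components, the one of g being
   positive. In this way the chart independence of the traces, which are computed
   in a chosen chart at each point, is not needed. *)

Section PositiveDefinite.
Context {F : numFieldType} {m : nat}.

Definition posdefmx (A : 'M[F]_m) : Prop :=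
  forall v : 'rV[F]_m, v != 0 -> 0 < (v *m A *m v^T) 0 0.

Lemma posdefmx_unit (A : 'M[F]_m) : posdefmx A -> A \in unitmx.
Proof.
move=> A_gt0; rewrite unitmxE unitfE; apply/det0P => -[v v_neq0 vA].
by have := A_gt0 v v_neq0; rewrite vA mul0mx mxE ltxx.
Qed.

Lemma posdefmx_diag_gt0 (A : 'M[F]_m) (a : 'I_m) : posdefmx A -> 0 < A a a.
Proof.
have e_neq0 : delta_mx 0 a != 0 :> 'rV[F]_m.
  apply/eqP => /matrixP /(_ 0 a); rewrite !mxE !eqxx => /eqP.
  by rewrite oner_eq0.
by move=> /(_ _ e_neq0); rewrite -rowE trmx_delta -colE !mxE.
Qed.

End PositiveDefinite.

Section SchwarzTheorem.
Context {R : realType} {V : normedModType R}.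
Implicit Types (h : V -> R) (x v w : V).

Lemma MVT_closed_segment (f df : R -> R) (a b : R) : a <= b ->
  {in `[a, b], forall s : R, is_derive s 1 f (df s)} ->
  exists2 c, c \in `[a, b] & f b - f a = df c * (b - a).
Proof.
move=> ab fdf; apply: MVT_segment => // [s s_in|].
  exact/fdf/subset_itv_oo_cc.
by apply: derivable_within_continuous => s /fdf[].
Qed.

Lemma is_derive_line h x v (s : R) : derivable h (x + s *: v) v ->
  is_derive s 1 (fun s => h (x + s *: v)) ('D_v h (x + s *: v)).
Proof.
move=> dh.
pose line s := x + s *: v.
have quotientE :
    (fun e : R => e^-1 *: ((h \o line \o shift s) (e *: 1) - h (line s))) =
    (fun e : R => e^-1 *: ((h \o shift (line s)) (e *: v) - h (line s))).
  apply/funext => e /=; congr (_ *: (h _ - _)).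
  by rewrite /line [e *: 1]mulr1 scalerDl addrCA.
by split; rewrite ?/derivable /derive [X in X @ _]quotientE.
Qed.

Definition second_difference h x v w (r : R) : R :=
  h (x + r *: v + r *: w) - h (x + r *: v) - h (x + r *: w) + h x.

Lemma second_differenceC h x v w :
  second_difference h x v w = second_difference h x w v.
Proof.
apply/funext => r; rewrite /second_difference.
by rewrite [x + _ + _]addrAC [_ - _ - _]addrAC.
Qed.

Lemma second_difference_MVT h x v w (r : R) : 0 <= r ->
  {in `[0, r] &, forall s t, derivable h (x + s *: v + t *: w) v} ->
  {in `[0, r] &, forall s t, derivable ('D_v h) (x + s *: v + t *: w) w} ->
  exists s t, [/\ s \in `[0, r], t \in `[0, r] &
    second_difference h x v w r = 'D_w ('D_v h) (x + s *: v + t *: w) * r ^+ 2].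
Proof.
move=> r_ge0 dv dvw.
have zero_in : 0 \in `[0, r] by rewrite in_itv/= lexx.
have r_in : r \in `[0, r] by rewrite in_itv/= r_ge0 lexx.
have [|s sr h_diff] := @MVT_closed_segment
    (fun s => h (x + r *: w + s *: v) - h (x + s *: v))
    (fun s => 'D_v h (x + r *: w + s *: v) - 'D_v h (x + s *: v)) _ _ r_ge0.
  move=> s sr; apply: is_deriveB; apply: is_derive_line.
    by rewrite addrAC; exact: dv.
  by have := dv s 0 sr zero_in; rewrite scale0r addr0.
have [|t tr dvh_diff] := @MVT_closed_segment
    (fun t => 'D_v h (x + s *: v + t *: w))
    (fun t => 'D_w ('D_v h) (x + s *: v + t *: w)) _ _ r_ge0.
  by move=> t tr; apply: is_derive_line; exact: dvw.
exists s, t; split=> //.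
move: h_diff dvh_diff; rewrite !scale0r !addr0 subr0 ![x + r *: w + _]addrAC.
by rewrite expr2 mulrA => + <- => <-; rewrite /second_difference; ring.
Qed.

Lemma near_parallelogram x v w (P : set V) : nbhs x P ->
  \forall r \near 0^'+, {in `[0, r] &, forall s t : R, P (x + s *: v + t *: w)}.
Proof.
move=> /nbhs_ballP[e /= e_gt0 xeP]; pose c := `|v| + `|w| + 1.
have c_gt0 : 0 < c by rewrite ltr_wpDl// addr_ge0.
near=> r => s t; rewrite !in_itv/= => /andP[s_ge0 sr] /andP[t_ge0 tr].
apply: xeP; rewrite -ball_normE /ball_/= -addrA opprD addNKr normrN.
apply: (@le_lt_trans _ _ (r * c)); last first.
  by rewrite -ltr_pdivlMr//; near: r; apply: nbhs_right_lt; rewrite divr_gt0.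
apply: (le_trans (ler_normD _ _)); rewrite !normrZ !ger0_norm//.
rewrite /c !mulrDr mulr1.
rewrite ler_wpDr ?(le_trans s_ge0)//.
by apply: lerD; apply: ler_wpM2r.
Unshelve. all: by end_near. Qed.

Lemma cvg_second_difference h x v w :
  (\forall y \near x, derivable h y v) ->
  (\forall y \near x, derivable ('D_v h) y w) ->
  {for x, continuous ('D_w ('D_v h))} ->
  second_difference h x v w r / r ^+ 2 @[r --> 0^'+] --> 'D_w ('D_v h) x.
Proof.
move=> dv dvw cvw; apply/cvgrPdist_lt => e e_gt0.
have close : \forall y \near x, `|'D_w ('D_v h) x - 'D_w ('D_v h) y| < e.
  by move/cvgrPdist_lt : cvw; apply.
apply: filterS2 (nbhs_right_gt 0)
  (near_parallelogram v w (filterI (filterI dv dvw) close)) => r r_gt0 square.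
have [||s [t [sr tr ->]]] := @second_difference_MVT h x v w r (ltW r_gt0).
- by move=> s t sr tr; have [[]] := square s t sr tr.
- by move=> s t sr tr; have [[]] := square s t sr tr.
by rewrite mulfK ?expf_neq0 ?gt_eqF//; have [] := square s t sr tr.
Qed.

Lemma schwarz_derive h x v w :
  (\forall y \near x, derivable h y v) ->
  (\forall y \near x, derivable h y w) ->
  (\forall y \near x, derivable ('D_v h) y w) ->
  (\forall y \near x, derivable ('D_w h) y v) ->
  {for x, continuous ('D_w ('D_v h))} ->
  {for x, continuous ('D_v ('D_w h))} ->
  'D_w ('D_v h) x = 'D_v ('D_w h) x.
Proof.
move=> dv dw dvw dwv cvw cwv.
apply: (norm_cvg_unique (cvg_second_difference dv dvw cvw)).
by rewrite second_differenceC; exact: cvg_second_difference.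
Qed.

End SchwarzTheorem.

Section SmoothFunctions.
Context {R : realType} {n : nat}.
Implicit Types (U : set 'rV[R]_n) (h k : 'rV[R]_n -> R) (x : 'rV[R]_n).

Lemma near_eq_open U h k x : open U -> (forall y, U y -> h y = k y) -> U x ->
  \near x, h x = k x.
Proof. by move=> oU hk Ux; apply: filterS (open_nbhs_nbhs (conj oU Ux)). Qed.

Lemma partial_eq_on U h k (a : 'I_n) : open U -> (forall x, U x -> h x = k x) ->
  forall x, U x -> partial a h x = partial a k x.
Proof. by move=> oU hk x Ux; exact: near_eq_derive (near_eq_open oU hk Ux). Qed.

Lemma partials_eq_on U h k (s : seq 'I_n) : open U ->
  (forall x, U x -> h x = k x) ->
  forall x, U x -> partials s h x = partials s k x.
Proof. by move=> oU hk; elim: s => //= a s; exact: partial_eq_on. Qed.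

Definition continuous_derivable_on U h : Prop := forall x, U x ->
  {for x, continuous h} /\ forall a : 'I_n, derivable h x (delta_mx 0 a).

Lemma continuous_derivable_on_eq U h k :
  open U -> (forall x, U x -> h x = k x) ->
  continuous_derivable_on U h -> continuous_derivable_on U k.
Proof.
move=> oU hk rh x Ux; have [ch dh] := rh x Ux.
have near_hk := near_eq_open oU hk Ux.
split=> [|a]; last exact: near_eq_derivable near_hk (dh a).
rewrite /prop_for /continuous_at -(hk x Ux); apply: cvg_trans ch.
exact: near_eq_cvg near_hk.
Qed.

Lemma smooth_on_continuous_derivable U h :
  smooth_on U h -> continuous_derivable_on U h.
Proof. by move=> sh; exact: (sh [::]). Qed.

Lemma smooth_on_eq U h k :
  open U -> (forall x, U x -> h x = k x) -> smooth_on U h -> smooth_on U k.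
Proof.
move=> oU hk sh s.
exact: continuous_derivable_on_eq oU (partials_eq_on s oU hk) (sh s).
Qed.

Lemma smooth_on_partial U h (a : 'I_n) :
  smooth_on U h -> smooth_on U (partial a h).
Proof.
by move=> sh s; have := sh (rcons s a); rewrite /partials foldr_rcons.
Qed.

Lemma smooth_on_coind U (P : set ('rV[R]_n -> R)) : open U ->
  (forall h, P h -> continuous_derivable_on U h) ->
  (forall h (a : 'I_n), P h ->
    exists2 k, P k & forall x, U x -> partial a h x = k x) ->
  P `<=` smooth_on U.
Proof.
move=> oU contP partialP h Ph s.
have [k Pk hk] : exists2 k, P k & forall x, U x -> partials s h x = k x.
  elim: s => [|a s [k Pk hk]]; first by exists h.
  have [l Pl kl] := partialP k a Pk; exists l => // x Ux.
  by rewrite -kl//; exact: partial_eq_on hk x Ux.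
by apply: continuous_derivable_on_eq oU _ (contP k Pk) => x Ux; rewrite hk.
Qed.

(* This class is closed under partial derivatives on [U], hence coinductively
   consists of smooth functions: the closure properties of smooth functions are
   all obtained at once. *)
Inductive smooth_expr U : ('rV[R]_n -> R) -> Prop :=
| SmoothExpr h of smooth_on U h : smooth_expr U h
| SmoothExprCst (c : R) : smooth_expr U (fun=> c)
| SmoothExprD h k of smooth_expr U h & smooth_expr U k :
    smooth_expr U (fun x => h x + k x)
| SmoothExprM h k of smooth_expr U h & smooth_expr U k :
    smooth_expr U (fun x => h x * k x)
| SmoothExprV h of (forall x, U x -> h x != 0) & smooth_expr U h :
    smooth_expr U (fun x => (h x)^-1).

Lemma smooth_expr_continuous_derivable U h :
  smooth_expr U h -> continuous_derivable_on U h.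
Proof.
elim=> {h} [h /smooth_on_continuous_derivable//|c|h k _ rh _ rk|h k _ rh _ rk
           |h h_neq0 _ rh] x Ux.
- by split=> [|a]; [exact: cst_continuous|exact: derivable_cst].
- have [[ch dh] [ck dk]] := (rh x Ux, rk x Ux).
  by split=> [|a]; [exact: continuousD ch ck|exact: derivableD].
- have [[ch dh] [ck dk]] := (rh x Ux, rk x Ux).
  by split=> [|a]; [exact: continuousM ch ck|exact: derivableM].
- have [ch dh] := rh x Ux.
  have hx_neq0 := h_neq0 x Ux.
  by split=> [|a]; [exact: continuousV hx_neq0 ch|exact: derivableV].
Qed.

Lemma smooth_expr_partial U h (a : 'I_n) : smooth_expr U h ->
  exists2 k, smooth_expr U k & forall x, U x -> partial a h x = k x.
Proof.
have derivable_expr k : smooth_expr U k ->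
    forall x, U x -> derivable k x (delta_mx 0 a).
  by move=> /smooth_expr_continuous_derivable rk x /rk[_]; exact.
elim=> {h} [h sh|c|h k eh [dh edh hdh] ek [dk edk kdk]
           |h k eh [dh edh hdh] ek [dk edk kdk]|h h_neq0 eh [dh edh hdh]].
- by exists (partial a h) => //; exact/SmoothExpr/smooth_on_partial.
- by exists (fun=> 0) => [|x _]; [exact: SmoothExprCst|exact: derive_cst].
- exists (fun x => dh x + dk x) => [|x Ux]; first exact: SmoothExprD.
  by rewrite -hdh// -kdk// /partial deriveD//; exact: derivable_expr.
- exists (fun x => h x * dk x + k x * dh x) => [|x Ux].
    by apply: SmoothExprD; exact: SmoothExprM.
  by rewrite -hdh// -kdk// /partial deriveM//; exact: derivable_expr.
- exists (fun x => -1 * ((h x)^-1 * (h x)^-1) * dh x) => [|x Ux].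
    have Vh := SmoothExprV h_neq0 eh.
    apply: SmoothExprM edh; apply: SmoothExprM; first exact: SmoothExprCst.
    exact: SmoothExprM.
  rewrite -hdh// /partial deriveV ?h_neq0//; last exact: derivable_expr.
  by rewrite mulN1r -invfM -expr2.
Qed.

Lemma smooth_expr_smooth U h : open U -> smooth_expr U h -> smooth_on U h.
Proof.
move=> oU; apply: (smooth_on_coind oU) => [k|k a].
  exact: smooth_expr_continuous_derivable.
exact: smooth_expr_partial.
Qed.

Lemma smooth_on_cst U (c : R) : open U -> smooth_on U (fun=> c).
Proof. by move=> oU; exact/smooth_expr_smooth/SmoothExprCst. Qed.

Lemma smooth_onD U h k : open U ->
  smooth_on U h -> smooth_on U k -> smooth_on U (fun x => h x + k x).
Proof.
move=> oU sh sk; apply: (smooth_expr_smooth oU).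
by apply: SmoothExprD; exact: SmoothExpr.
Qed.

Lemma smooth_onM U h k : open U ->
  smooth_on U h -> smooth_on U k -> smooth_on U (fun x => h x * k x).
Proof.
move=> oU sh sk; apply: (smooth_expr_smooth oU).
by apply: SmoothExprM; exact: SmoothExpr.
Qed.

Lemma smooth_onV U h : open U -> (forall x, U x -> h x != 0) ->
  smooth_on U h -> smooth_on U (fun x => (h x)^-1).
Proof.
move=> oU h_neq0 sh; apply: (smooth_expr_smooth oU).
by apply: (SmoothExprV h_neq0); exact: SmoothExpr.
Qed.

Lemma smooth_onN U h : open U -> smooth_on U h -> smooth_on U (fun x => - h x).
Proof.
move=> oU sh; under [fun x => _]funext do rewrite -mulN1r.
by apply: (smooth_onM oU _ sh); exact: smooth_on_cst.
Qed.

Lemma smooth_on_sum U (I : Type) (r : seq I) (P : pred I)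
    (F : I -> 'rV[R]_n -> R) : open U -> (forall i, P i -> smooth_on U (F i)) ->
  smooth_on U (fun x => \sum_(i <- r | P i) F i x).
Proof.
move=> oU sF; rewrite -fct_sumE; apply: big_ind sF; first exact: smooth_on_cst.
by move=> h k; exact: smooth_onD.
Qed.

Lemma smooth_on_prod U (I : Type) (r : seq I) (P : pred I)
    (F : I -> 'rV[R]_n -> R) : open U -> (forall i, P i -> smooth_on U (F i)) ->
  smooth_on U (fun x => \prod_(i <- r | P i) F i x).
Proof.
move=> oU sF; rewrite -fct_prodE; apply: big_ind sF; first exact: smooth_on_cst.
by move=> h k; exact: smooth_onM.
Qed.

Lemma smooth_on_det U (m : nat) (A : 'rV[R]_n -> 'M[R]_m) : open U ->
  (forall a b, smooth_on U (fun x => A x a b)) ->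
  smooth_on U (fun x => \det (A x)).
Proof.
move=> oU sA; apply: smooth_on_sum => // s _.
apply: (smooth_onM oU); first exact: smooth_on_cst.
exact: smooth_on_prod.
Qed.

Lemma smooth_on_cofactor U (m : nat) (A : 'rV[R]_n -> 'M[R]_m) : open U ->
  (forall a b, smooth_on U (fun x => A x a b)) ->
  forall a b, smooth_on U (fun x => cofactor (A x) a b).
Proof.
move=> oU sA a b; apply: (smooth_onM oU); first exact: smooth_on_cst.
apply: (smooth_on_det oU) => c d.
by under [fun x => _]funext do rewrite !mxE; exact: sA.
Qed.

Lemma smooth_on_invmx U (m : nat) (A : 'rV[R]_n -> 'M[R]_m) : open U ->
  (forall x, U x -> A x \in unitmx) ->
  (forall a b, smooth_on U (fun x => A x a b)) ->
  forall a b, smooth_on U (fun x => invmx (A x) a b).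
Proof.
move=> oU uA sA a b.
apply: (@smooth_on_eq U (fun x => (\det (A x))^-1 * cofactor (A x) b a)) => //.
  by move=> x Ux; rewrite /invmx uA// !mxE.
apply: (smooth_onM oU _ (smooth_on_cofactor oU sA b a)).
apply: (smooth_onV oU _ (smooth_on_det oU sA)).
by move=> x /uA; rewrite unitmxE unitfE.
Qed.

Lemma partialC U h (a b : 'I_n) : open U -> smooth_on U h ->
  forall x, U x -> partial a (partial b h) x = partial b (partial a h) x.
Proof.
move=> oU sh x Ux.
have near_derivable k c : smooth_on U k ->
    \forall y \near x, derivable k y (delta_mx 0 c).
  move=> /smooth_on_continuous_derivable rk.
  by apply: filterS (open_nbhs_nbhs (conj oU Ux)) => y /rk[_]; exact.
have continuous_at_x k : smooth_on U k -> {for x, continuous k}.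
  by move=> /smooth_on_continuous_derivable /(_ x Ux)[].
have [sa sb] := (smooth_on_partial a sh, smooth_on_partial b sh).
apply: schwarz_derive.
- exact: near_derivable sh.
- exact: near_derivable sh.
- exact: near_derivable sb.
- exact: near_derivable sa.
- exact/continuous_at_x/smooth_on_partial/sb.
- exact/continuous_at_x/smooth_on_partial/sa.
Qed.

End SmoothFunctions.

#[local] Arguments codom_open {R n s} i.

Section Charts.
Context {R : realType} {n : nat} {M : smoothManifold R n}.
Implicit Types (i : chart M) (p : M) (h k f : M -> R) (a b c d : 'I_n).

Local Notation chart_image i := (Defs.coord i @` dom i).

Lemma paramK i x : chart_image i x ->
  dom i (param i x) /\ Defs.coord i (param i x) = x.
Proof. by case=> p ip <-; rewrite Defs.coordK. Qed.

Lemma pd_eq_on i a h k : (forall p, dom i p -> h p = k p) ->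
  forall p, dom i p -> pd i a h p = pd i a k p.
Proof.
move=> hk p ip; rewrite /pd.
apply: (partial_eq_on (U := chart_image i)); [exact: codom_open| |by exists p].
by move=> x /paramK[+ _]; exact: hk.
Qed.

Lemma pd_param i a h x : chart_image i x ->
  pd i a h (param i x) = partial a (h \o param i) x.
Proof. by rewrite /pd => /paramK[_ ->]. Qed.

Lemma pdC i a b h : smooth_on_chart i h ->
  forall p, dom i p -> pd i a (pd i b h) p = pd i b (pd i a h) p.
Proof.
move=> sh p ip; have Up : chart_image i (Defs.coord i p) by exists p.
have oU := codom_open i.
have pd_pd c d :
    pd i c (pd i d h) p = partial c (partial d (h \o param i)) (Defs.coord i p).
  by apply: (partial_eq_on c oU _ Up) => x; exact: pd_param.
by rewrite !pd_pd; exact: partialC oU sh _ Up.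
Qed.

Lemma smooth_on_chart_eq i h k : (forall p, dom i p -> h p = k p) ->
  smooth_on_chart i h -> smooth_on_chart i k.
Proof.
move=> hk; apply: (smooth_on_eq (codom_open i)) => x /paramK[+ _].
exact: hk.
Qed.

Lemma smooth_on_chart_pd i a h :
  smooth_on_chart i h -> smooth_on_chart i (pd i a h).
Proof.
move=> /(smooth_on_partial a).
by apply: (smooth_on_eq (codom_open i)) => x Ux; rewrite -pd_param.
Qed.

Lemma smooth_on_chart_cst i (r : R) : smooth_on_chart i (fun=> r).
Proof. exact: (smooth_on_cst r (codom_open i)). Qed.

Lemma smooth_on_chartD i h k : smooth_on_chart i h -> smooth_on_chart i k ->
  smooth_on_chart i (fun p => h p + k p).
Proof. exact: (smooth_onD (codom_open i)). Qed.

Lemma smooth_on_chartB i h k : smooth_on_chart i h -> smooth_on_chart i k ->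
  smooth_on_chart i (fun p => h p - k p).
Proof.
move=> sh sk; apply: (smooth_on_chartD sh).
exact: (smooth_onN (codom_open i)).
Qed.

Lemma smooth_on_chartM i h k : smooth_on_chart i h -> smooth_on_chart i k ->
  smooth_on_chart i (fun p => h p * k p).
Proof. exact: (smooth_onM (codom_open i)). Qed.

Lemma smooth_on_chart_div i h k : (forall p, dom i p -> k p != 0) ->
  smooth_on_chart i h -> smooth_on_chart i k ->
  smooth_on_chart i (fun p => h p / k p).
Proof.
move=> k_neq0 sh sk; apply: (smooth_on_chartM sh).
apply: (smooth_onV (codom_open i) _ sk) => x /paramK[+ _].
exact: k_neq0.
Qed.

Lemma smooth_on_chart_sum i (I : Type) (r : seq I) (P : pred I)
    (F : I -> M -> R) :
  (forall e, P e -> smooth_on_chart i (F e)) ->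
  smooth_on_chart i (fun p => \sum_(e <- r | P e) F e p).
Proof. exact: (smooth_on_sum r (codom_open i)). Qed.

Lemma dom_chart_at p : dom (chart_at p) p.
Proof. exact: (svalP (cid (chart_cover p))). Qed.

End Charts.

Section TensorFields.
Context {R : realType} {n : nat} {M : smoothManifold R n}.
Implicit Types (i : chart M) (f : M -> R) (t : chart M -> M -> 'rV[R]_n)
  (S T : chart M -> M -> 'M[R]_n).

Definition smooth_covector t : Prop :=
  forall i a, smooth_on_chart i (fun p => t i p 0 a).

Definition closed_covector t : Prop := forall i p, dom i p -> forall a b,
  pd i a (fun q => t i q 0 b) p = pd i b (fun q => t i q 0 a) p.

Definition smooth_tensor2 T : Prop :=
  forall i a b, smooth_on_chart i (fun p => T i p a b).

Lemma smooth_tensor2B S T : smooth_tensor2 S -> smooth_tensor2 T ->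
  smooth_tensor2 (fun i p => S i p - T i p).
Proof.
move=> sS sT i a b; under [fun p => _]funext do rewrite !mxE.
exact: smooth_on_chartB.
Qed.

Lemma differentialE f i a : (fun p => differential f i p 0 a) = pd i a f.
Proof. by apply/funext => p; rewrite mxE. Qed.

Lemma smooth_differential f : smooth f -> smooth_covector (differential f).
Proof. by move=> sf i a; rewrite differentialE; exact/smooth_on_chart_pd. Qed.

Lemma closed_differential f : smooth f -> closed_covector (differential f).
Proof. by move=> sf i p ip a b; rewrite !differentialE; exact: pdC. Qed.

End TensorFields.

Section LeviCivita.
Context {R : realType} {n : nat} {M : smoothManifold R n}.
Variable g : riemannianMetric M.
Implicit Types (i : chart M) (p : M) (f : M -> R) (a b c d : 'I_n)
  (s t : chart M -> M -> 'rV[R]_n) (S T : chart M -> M -> 'M[R]_n).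

Lemma metric_posdef i p : dom i p -> posdefmx (g i p).
Proof. by move=> ip v; exact: metric_pos. Qed.

Lemma smooth_ginv : smooth_tensor2 (ginv g).
Proof.
move=> i a b; apply: (smooth_on_invmx (codom_open i)
    (A := fun x => g i (param i x))) => [x /paramK[ix _]|c d].
  exact/posdefmx_unit/metric_posdef.
exact: metric_smooth.
Qed.

Lemma smooth_christoffel i c a b : smooth_on_chart i (christoffel g i c a b).
Proof.
apply: smooth_on_chartM; first exact: smooth_on_chart_cst.
apply: smooth_on_chart_sum => d _.
apply: smooth_on_chartM; first exact: smooth_ginv.
by apply: smooth_on_chartB; first apply: smooth_on_chartD;
  exact/smooth_on_chart_pd/metric_smooth.
Qed.

Lemma christoffel_sym i c a b p : dom i p ->
  christoffel g i c a b p = christoffel g i c b a p.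
Proof.
move=> ip; congr (_ * _); apply: eq_bigr => d _; congr (_ * (_ - _)).
  by rewrite addrC.
by apply: pd_eq_on ip => q iq; rewrite -[in LHS](Defs.metric_sym g iq) mxE.
Qed.

Lemma smooth_riemann i a b c d : smooth_on_chart i (riemann g i a b c d).
Proof.
apply: smooth_on_chartD.
  by apply: smooth_on_chartB; exact/smooth_on_chart_pd/smooth_christoffel.
apply: smooth_on_chart_sum => e _.
by apply: smooth_on_chartB; apply: smooth_on_chartM; exact: smooth_christoffel.
Qed.

Lemma smooth_Ric : smooth_tensor2 (Ric g).
Proof.
move=> i a b; under [fun p => _]funext do rewrite mxE.
by apply: smooth_on_chart_sum => c _; exact: smooth_riemann.
Qed.

Lemma smooth_nabla t : smooth_covector t -> smooth_tensor2 (nabla g t).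
Proof.
move=> st i a b; under [fun p => _]funext do rewrite mxE.
apply: smooth_on_chartB; first exact/smooth_on_chart_pd/st.
apply: smooth_on_chart_sum => c _.
by apply: smooth_on_chartM; [exact: smooth_christoffel|exact: st].
Qed.

Lemma nabla_sym t i p : closed_covector t -> dom i p ->
  (nabla g t i p)^T = nabla g t i p.
Proof.
move=> closed_t ip; apply/matrixP => a b; rewrite !mxE (closed_t _ _ ip).
by congr (_ - _); apply: eq_bigr => c _; rewrite christoffel_sym.
Qed.

Lemma nabla_eq s t : covector_eq s t -> tensor2_eq (nabla g s) (nabla g t).
Proof.
move=> st i p ip; apply/matrixP => a b; rewrite !mxE (st i p ip); congr (_ - _).
by apply: pd_eq_on ip => q iq; rewrite st.
Qed.

Lemma trace_g_eq S T : tensor2_eq S T -> trace_g g S = trace_g g T.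
Proof.
move=> ST; apply/funext => p; apply: eq_bigr => a _; apply: eq_bigr => b _.
by rewrite ST//; exact: dom_chart_at.
Qed.

Lemma delta_exact t f : covector_eq t (differential f) ->
  delta g t = (fun p => - laplacian g f p).
Proof. by move=> tdf; rewrite /delta (trace_g_eq (nabla_eq tdf)). Qed.

Lemma deltastar_exact t f : smooth f -> covector_eq t (differential f) ->
  tensor2_eq (deltastar g t) (Hess g f).
Proof.
move=> sf /nabla_eq tdf i p ip; rewrite /deltastar tdf//.
rewrite nabla_sym//; last exact: closed_differential.
rewrite -mulr2n -[Hess _ _ _ _ *+ 2]scaler_nat.
by rewrite scalerA mulVf ?pnatr_eq0// scale1r.
Qed.

Lemma Ric_sub_Hess t f (c : M -> R) :
  smooth f -> covector_eq t (differential f) ->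
  tensor2_eq (einstein g) (fun i p => Bstar g t i p + c p *: g i p) ->
  tensor2_eq (fun i p => Ric g i p - Hess g f i p)
    (fun i p => (c p + 2^-1 * scal g p - 2^-1 * laplacian g f p) *: g i p).
Proof.
move=> sf tdf einsteinE i p ip; move/eqP: (einsteinE i p ip).
rewrite /einstein /Bstar (deltastar_exact sf tdf)// (delta_exact tdf) subr_eq.
move=> /eqP ->; move: (Hess g f i p) (g i p) => H G.
by apply/matrixP => a b; rewrite !mxE; ring.
Qed.

(* On a diagonal entry, [lam] is the quotient [T_aa / g_aa] in every chart. *)
Lemma smooth_conformal_factor T (lam : M -> R) :
  (0 < n)%N -> smooth_tensor2 T ->
  tensor2_eq T (fun i p => lam p *: g i p) -> smooth lam.
Proof.
move=> n_gt0 sT Tg i; pose a := Ordinal n_gt0.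
have gaa_neq0 p : dom i p -> g i p a a != 0.
  by move=> ip; rewrite gt_eqF//; exact/posdefmx_diag_gt0/metric_posdef.
apply: (smooth_on_chart_eq (h := fun p => T i p a a / g i p a a)).
  by move=> p ip; rewrite Tg// mxE mulfK// gaa_neq0.
by apply: smooth_on_chart_div => //; exact: metric_smooth.
Qed.

End LeviCivita.

Theorem theorem4p1 (R : realType) (n : nat) (M : smoothManifold R n)
    (g : riemannianMetric M) (theta : oneForm M) (f : M -> R)
    (M_compact : compact [set: M])
    (n_ge3 : (3 <= n)%N)
    (g_critical : Chen_Nagano_equation g theta)
    (f_smooth : smooth f)
    (theta_exact : covector_eq theta (differential f)) :
  gradient_Ricci_almost_soliton g f
    (fun p : M => CN_const g + 2^-1 * scal g p - 2^-1 * laplacian g f p).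
Proof.
have soliton :=
  Ric_sub_Hess (c := fun=> CN_const g) f_smooth theta_exact g_critical.
split; [exact: f_smooth| |exact: soliton].
apply: smooth_conformal_factor soliton; first exact: ltn_trans n_ge3.
apply: smooth_tensor2B; first exact: smooth_Ric.
exact/smooth_nabla/smooth_differential.
Qed.
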